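(* Let $m<n$ be positive integers and let $Q$ be an $m$-vertex directed graph with adjacency matrix $A_Q=[q_{ij}]_{m\times m}$. Then $Q$ is a quotient graph of some $n$-vertex symmetric directed graph $G$ by a balanced equivalence relation on the set of vertices of $G$ if and only if there are positive integers $k_1,\ldots,k_m$ with $k_1+\cdots+k_m=n$ such that $$k_i q_{ij}=k_j q_{ji}\qquad\text{for all } i,j\in\{1,\ldots,m\}.$$
   Context: Directed graphs are finite and may have loops and multiple edges. The adjacency matrix of a directed graph with vertices $1,\ldots,n$ is the $n\times n$ matrix of non-negative integers whose $(i,j)$ entry is the number of directed edges from vertex $j$ to vertex $i$. A directed graph is symmetric (bidirected) if its adjacency matrix is symmetric. An equivalence relation $\bowtie$ on the vertex set of a directed graph $G$ is balanced if, for any two vertices $u,v$ in the same $\bowtie$-class and any $\bowtie$-class $C$, the number of directed edges from vertices of $C$ to $u$ equals the number of directed edges from vertices of $C$ to $v$. For a balanced $\bowtie$ with classes $I_1,\ldots,I_m$, the quotient graph $G/\bowtie$ has one vertex for each class, and its edges are the projections of the edges of $G$: its adjacency matrix $[q_{ij}]_{m\times m}$ is given by letting $q_{ij}$ be the number of directed edges of $G$ from vertices of $I_j$ to any given vertex of $I_i$ (well defined since $\bowtie$ is balanced). $Q$ is a quotient graph of $G$ by $\bowtie$ if $Q=G/\bowtie$, under some labelling of the classes by the vertices of $Q$. *)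

(* Defs.v *)
From mathcomp Require Import all_boot all_order all_algebra.

Set Implicit Arguments.
Unset Strict Implicit.
Unset Printing Implicit Defensive.

Record digraph (n : nat) := Digraph {
  edge : finType;
  source : edge -> 'I_n;
  target : edge -> 'I_n
}.

(* The entry (i, j) counts the edges from j to i, in this order. *)
Definition adjacency (n : nat) (G : digraph n) : 'M[nat]_n :=
  \matrix_(i < n, j < n)
    #|[set e : edge G | (source e == j) && (target e == i)]|.

(* A loop is a single directed edge, so it contributes 1 to the diagonal. *)
Definition symmetric_digraph (n : nat) (G : digraph n) : Prop :=
  trmx (adjacency G) = adjacency G.

Definition edges_from_to (n : nat) (G : digraph n) (C : {set 'I_n})
    (u : 'I_n) : nat :=
  #|[set e : edge G | (source e \in C) && (target e == u)]|.

Definition classes (n : nat) (R : rel 'I_n) : {set {set 'I_n}} :=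
  equivalence_partition R [set: 'I_n].

Definition balanced (n : nat) (G : digraph n) (R : rel 'I_n) : Prop :=
  equivalence_rel R /\
  forall (u v : 'I_n) (C : {set 'I_n}), R u v -> C \in classes R ->
    edges_from_to G C u = edges_from_to G C v.

(* Q = G / R, with the vertex i of Q labelling the class I i.  Edges carry no
   identity beyond their endpoints, so equality of graphs on the same vertex
   set is equality of adjacency matrices. *)
Definition quotient_graph (m n : nat) (Q : digraph m) (G : digraph n)
    (R : rel 'I_n) : Prop :=
  exists I : 'I_m -> {set 'I_n},
    [/\ injective I,
        [set I i | i : 'I_m] = classes R &
        forall (i j : 'I_m) (u : 'I_n), u \in I i ->
          adjacency Q i j = edges_from_to G (I j) u].

(* Main.v *)
(** Write a vertex of G in the class I_i as a pair (i, a) with a < k_i.  For the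
    converse, join (i, a) and (j, b) by one edge for each
    t < k_i q_ij = k_j q_ji with t = a mod k_i and t = b mod k_j.  This is
    symmetric in the two vertices.  For fixed a, each such t = a mod k_i
    determines exactly one b, so (i, a) receives
    #{t < k_i q_ij | t = a mod k_i} = q_ij edges from the class I_j. *)
Require Import Defs.
From mathcomp Require Import all_boot all_order all_algebra.

Lemma edges_from_toE {n : nat} (G : digraph n) (C : {set 'I_n}) (u : 'I_n) :
  edges_from_to G C u = \sum_(v in C) adjacency G u v.
Proof.
rewrite /edges_from_to -sum1_card (partition_big (@source n G) (mem C)) /=.
  apply: eq_bigr => v vC; rewrite mxE -sum1_card; apply: eq_bigl => e.
  rewrite !inE; case: (source e =P v) => [->|_]; last by rewrite andbF.
  by rewrite vC andbT.
by move=> e; rewrite inE => /andP[].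
Qed.

(** Take as edges the disjoint union over pairs [(i, j)] of the ordinals below [A i j], with target
    [i] and source [j]. Hence a graph may be specified by its matrix alone. *)
Lemma digraph_of_adjacency {n : nat} (A : 'M[nat]_n) :
  exists G : digraph n, adjacency G = A.
Proof.
pose E : finType := {p : 'I_n * 'I_n & 'I_(A p.1 p.2)}.
exists (@Digraph n E (fun e => (tag e).2) (fun e => (tag e).1)).
apply/matrixP=> i j; rewrite mxE.
have -> : [set e : E | ((tag e).2 == j) && ((tag e).1 == i)]
        = [set Tagged (fun p : 'I_n * 'I_n => 'I_(A p.1 p.2)) x
             | x : 'I_(A (i, j).1 (i, j).2)].
  apply/setP=> e; rewrite inE; apply/idP/imsetP => [|[x _ ->]]; last first.
    by rewrite /= !eqxx.
  case: e => -[a b] x /= /andP[/eqP eb /eqP ea].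
  by subst; exists x.
by rewrite card_imset ?card_ord //; apply: eq_from_Tagged.
Qed.

(** The range splits into [q] blocks of length [k], and each block meets the residue [a] exactly
    once. *)
Lemma sum_modn_eq (k q a : nat) : a < k -> \sum_(t < k * q) (t %% k == a) = q.
Proof.
move=> lt_ak; elim: q => [|q IHq]; first by rewrite muln0 big_ord0.
rewrite mulnS big_split_ord /= -[RHS]add1n; congr (_ + _).
  rewrite (bigD1 (Ordinal lt_ak)) //= modn_small // eqxx big1 // => t.
  by rewrite -val_eqE /= modn_small // => /negbTE->.
by rewrite -[RHS]IHq; apply: eq_bigr => t _; rewrite modnDl.
Qed.

(** Take [k i] to be the size of the class [I i]. Then the two sides count the edges from [I j] to
    [I i] and those from [I i] to [I j], and symmetry of [G] equates these. *)
Lemma symmetric_quotient_balance {m n : nat} (Q : digraph m) (G : digraph n)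
    (R : rel 'I_n) :
  symmetric_digraph G -> balanced G R -> quotient_graph Q G R ->
  exists k : 'I_m -> nat,
    [/\ forall i, 0 < k i, \sum_(i < m) k i = n &
        forall i j, k i * adjacency Q i j = k j * adjacency Q j i].
Proof.
move=> symG [eqR _] [I [injI imI QI]].
have partR : partition (classes R) [set: 'I_n].
  by apply: equivalence_partitionP => x y z _ _ _; apply: eqR.
have count i j :
    #|I i| * adjacency Q i j = \sum_(u in I i) \sum_(v in I j) adjacency G u v.
  rewrite -sum_nat_const; apply: eq_bigr => u uI.
  by rewrite (QI _ _ _ uI) edges_from_toE.
exists (fun i => #|I i|); split=> [i||i j].
- rewrite card_gt0; case/and3P: partR => _ _ /negP n0.
  by apply/eqP => Ii0; case: n0; rewrite -imI -Ii0 imset_f.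
- rewrite -[RHS]card_ord -cardsT (card_partition partR) -imI.
  by rewrite big_imset //= => i j _ _; apply: injI.
- rewrite !count exchange_big; apply: eq_bigr => u _; apply: eq_bigr => v _.
  by rewrite -[in LHS]symG mxE.
Qed.

Lemma balance_symmetric_quotient {m n : nat} (Q : digraph m) (k : 'I_m -> nat) :
  (forall i, 0 < k i) -> \sum_(i < m) k i = n ->
  (forall i j, k i * adjacency Q i j = k j * adjacency Q j i) ->
  exists (G : digraph n) (R : rel 'I_n),
    [/\ symmetric_digraph G, balanced G R & quotient_graph Q G R].
Proof.
move=> k_gt0 sum_k kQ.
pose T : finType := {i : 'I_m & 'I_(k i)}.
have cardT : #|T| = n.
  rewrite card_tagged sumnE big_map big_enum -[RHS]sum_k /=.
  by apply: eq_bigr => i _; rewrite card_ord.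
(* The bijection [f] reads a vertex as a pair: [c u] is its class and [r u] its position in that
   class. *)
pose f (u : 'I_n) : T := enum_val (cast_ord (esym cardT) u).
have bij_f : bijective f.
  apply: bij_comp; first exact: enum_val_bij.
  by exists (cast_ord cardT) => x; rewrite ?cast_ordK ?cast_ordKV.
pose c u := tag (f u).
pose r u : nat := tagged (f u).
have lt_rk u : r u < k (c u) by exact: ltn_ord.
have vertex i a : a < k i -> exists2 u, c u = i & r u = a.
  case: bij_f => g _ gK lt_ak.
  exists (g (Tagged (fun i => 'I_(k i)) (Ordinal lt_ak)));
    by rewrite /c /r gK.
have vertex_inj u v : c u = c v -> r u = r v -> u = v.
  move=> cuv ruv; apply: (bij_inj bij_f); move: cuv ruv; rewrite /c /r.
  case: (f u) (f v) => [i a] [j b] /= eij; subst j => /val_inj ->.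
  by [].
pose A : 'M[nat]_n := (\matrix_(u, v)
  (\sum_(t < k (c u) * adjacency Q (c u) (c v))
    ((t %% k (c u) == r u) && (t %% k (c v) == r v)))%N)%R.
have [G adjG] := digraph_of_adjacency A.
pose I i := [set u | c u == i].
have edgesI j u : edges_from_to G (I j) u = adjacency Q (c u) j.
  rewrite edges_from_toE adjG.
  rewrite -[RHS](sum_modn_eq (k (c u)) _ (r u) (lt_rk u)).
  have sumA v : v \in I j -> A u v =
      \sum_(t < k (c u) * adjacency Q (c u) j)
        ((t %% k (c u) == r u) && (t %% k j == r v)).
    by rewrite inE mxE => /eqP->.
  (* With [t] fixed, only the vertex of [I j] at position [t %% k j] contributes, so the inner sum
     reduces to the condition on [r u]. *)
  rewrite (eq_bigr _ sumA) exchange_big; apply: eq_bigr => t _ /=.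
  have [v cv rv] := vertex j (t %% k j) (ltn_pmod _ (k_gt0 j)).
  rewrite (bigD1 v) ?inE ?cv //= rv eqxx andbT big1 ?addn0 // => w.
  rewrite inE => /andP[/eqP cw ne_wv]; case: (_ =P r w) => [rw|_].
    by case/eqP: ne_wv; apply: vertex_inj; rewrite ?cw ?cv ?rv.
  by rewrite andbF.
pose R : rel 'I_n := fun u v => c u == c v.
have classE u : [set v in [set: 'I_n] | R u v] = I (c u).
  by apply/setP=> v; rewrite !inE /= eq_sym.
have imI : [set I i | i : 'I_m] = classes R.
  apply/setP=> C; apply/imsetP/imsetP => [[i _ ->]|[u _ ->]].
    (* Position 0 exists because [k i] is positive, so [I i] is nonempty and is a genuine class. *)
    have [u <- _] := vertex i 0 (k_gt0 i).
    by exists u; rewrite ?inE ?classE.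
  by exists (c u); rewrite ?classE.
exists G, R; split.
(* By [kQ], the range of [t] is the same for [(u, v)] and [(v, u)]. *)
- rewrite /symmetric_digraph adjG; apply/matrixP=> u v; rewrite mxE 2![A _ _]mxE kQ.
  by apply: eq_bigr => t _; rewrite andbC.
(* Balance holds because, by [edgesI], the count depends on [u] only through [c u]. *)
- split=> [x y z|u v C /eqP cuv].
    by rewrite /R eqxx; split=> // /eqP ->.
  by rewrite -imI => /imsetP[i _ ->]; rewrite !edgesI cuv.
- exists I; split=> // [i j eqI|i j u].
    have [u cu _] := vertex i 0 (k_gt0 i).
    by have: u \in I i by [rewrite inE cu]; rewrite eqI inE cu => /eqP.
  by rewrite inE edgesI => /eqP->.
Qed.

Theorem theorem2p1 (m n : nat) (m_gt0 : 0 < m) (lt_mn : m < n)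
    (Q : digraph m) :
  (exists (G : digraph n) (R : rel 'I_n),
     [/\ symmetric_digraph G, balanced G R & quotient_graph Q G R])
  <->
  (exists k : 'I_m -> nat,
     [/\ forall i : 'I_m, 0 < k i,
         \sum_(i < m) k i = n &
         forall i j : 'I_m,
           k i * adjacency Q i j = k j * adjacency Q j i]).
Proof.
split=> [[G [R [symG balG quotG]]]|[k [k_gt0 sum_k kQ]]].
  exact: symmetric_quotient_balance symG balG quotG.
exact: balance_symmetric_quotient kQ.
Qed.
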